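(* Fix a risk level $\alpha\in(0,1)$ and a transient MDP with a sink state as in the context. Let $\delta>0$ and let $\beta_0>0$ (with $\beta_0<-\log(\alpha)/\delta$) be chosen such that $g^\star_\infty(0)-g^\star_\infty(\beta_0)\le\delta$. Let \[ (\pi^\star,\beta^\star)\in\arg\max_{(\pi,\beta)\in\Pi_{\mathrm{SD}}\times\mathcal B(\beta_0,\delta)}h_\infty(\pi,\beta). \] Then the limits below exist and \[ \lim_{t\to\infty}\mathrm{EVaR}^{\pi^\star,\mu}_\alpha\Big[\sum_{k=0}^t r(\tilde s_k,\tilde a_k,\tilde s_{k+1})\Big]\;\ge\;\sup_{\pi\in\Pi_{\mathrm{HR}}}\lim_{t\to\infty}\sup_{\beta>0}h_t(\pi,\beta)-\delta. \]
   Context: MDP: states $\bar{\mathcal S}=\{1,\dots,S,S+1\}$, $e:=S+1$ a sink state, $\mathcal S=\{1,\dots,S\}$; finite actions; transitions $p(s,a,s')$, real rewards $r(s,a,s')$ of arbitrary sign; $p(e,a,e)=1$, $r(e,a,e)=0$; initial distribution $\mu$ on $\mathcal S$ with $\mu>0$. $\Pi_{\mathrm{HR}}$: history-dependent randomized policies; $\Pi_{\mathrm{SD}}$: stationary deterministic policies. Transience: for every $\pi\in\Pi_{\mathrm{SD}}$, $\sum_{t\ge0}\mathbb P^{\pi,s}[\tilde s_t=s']<\infty$ for all $s,s'\in\mathcal S$. $\mathrm{ERM}_\beta[\tilde x]=-\beta^{-1}\log\mathbb E e^{-\beta\tilde x}$ for $\beta>0$, $\mathrm{ERM}_0=\mathbb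 E$. $\mathrm{EVaR}_\alpha[\tilde x]=\sup_{\beta>0}\big(\mathrm{ERM}_\beta[\tilde x]+\beta^{-1}\log\alpha\big)$. $g_t(\pi,\beta)=\mathrm{ERM}^{\pi,\mu}_\beta[\sum_{k=0}^t r(\tilde s_k,\tilde a_k,\tilde s_{k+1})]$, $g^\star_t(\beta)=\sup_{\pi\in\Pi_{\mathrm{HR}}}g_t(\pi,\beta)$, $g_\infty(\pi,\beta)=\liminf_t g_t(\pi,\beta)$, $g^\star_\infty(\beta)=\liminf_t g^\star_t(\beta)$ (for $\beta=0$ defined via expectation). $h_t(\pi,\beta)=g_t(\pi,\beta)+\beta^{-1}\log\alpha$, $h_\infty(\pi,\beta)=g_\infty(\pi,\beta)+\beta^{-1}\log\alpha$. The finite set $\mathcal B(\beta_0,\delta)=\{\beta_0,\beta_1,\dots,\beta_K\}$ with $0<\beta_0<\beta_1<\dots<\beta_K$ is given by $\beta_{k+1}=\frac{\beta_k\log\alpha}{\beta_k\delta+\log\alpha}$ for the intermediate indices (i.e. $\beta_{k+1}^{-1}=\beta_k^{-1}+\delta/\log\alpha$), continued while the values stay below $-\log(\alpha)/\delta$, and $\beta_K=-\log(\alpha)/\delta$. *)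

(* Defs.v *)
From HB Require Import structures.
From mathcomp Require Import all_boot all_order all_algebra.
From mathcomp Require Import all_classical all_reals all_analysis.
Set Implicit Arguments. Unset Strict Implicit. Unset Printing Implicit Defensive.
Import Order.TTheory GRing.Theory Num.Theory.
Import numFieldNormedType.Exports.
Local Open Scope classical_set_scope.
Local Open Scope ring_scope.

Section MDP.
Variable R : realType.
Variable S : nat.
(* States: 'I_S.+1; indices 0..S-1 form the non-sink set 𝒮, index S (= ord_max)
   is the sink e. *)
Notation state := 'I_S.+1.
Definition sink : state := ord_max.
Variable A : finType.
Variable p : state -> A -> state -> R.
Variable r : state -> A -> state -> R.

(* History-dependent randomized policy: given the past (s_0,a_0),...,(s_{t-1},a_{t-1})
   and current state s_t, a probability weight on actions. *)
Definition policy := seq (state * A) -> state -> A -> R.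

Definition is_HR (pi : policy) : Prop :=
  forall (past : seq (state * A)) (s : state),
    (forall a, 0 <= pi past s a) /\ \sum_(a : A) pi past s a = 1.

Definition SD_policy (d : state -> A) : policy :=
  fun _ s a => if a == d s then 1 else 0.

Definition next_state (h : seq (state * A)) (sf : state) : state :=
  match h with [::] => sf | (s, _) :: _ => s end.

Fixpoint path_w (pi : policy) (past h : seq (state * A)) (sf : state) : R :=
  match h with
  | [::] => 1
  | (s, a) :: h' =>
      pi past s a * p s a (next_state h' sf) * path_w pi (rcons past (s, a)) h' sf
  end.

(* P^{pi,nu}[ (s_0,a_0),...,(s_t,a_t), s_{t+1} ] where h = [(s_0,a_0);...;(s_t,a_t)]
   and sf = s_{t+1}. For h = [::] this is nu sf = P[s_0 = sf]. *)
Definition traj_prob (nu : state -> R) (pi : policy) (h : seq (state * A)) (sf : state) : R :=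
  nu (next_state h sf) * path_w pi [::] h sf.

Fixpoint ret (h : seq (state * A)) (sf : state) : R :=
  match h with
  | [::] => 0
  | (s, a) :: h' => r s a (next_state h' sf) + ret h' sf
  end.

Definition state_prob (nu : state -> R) (pi : policy) (t : nat) (s' : state) : R :=
  \sum_(h : t.-tuple (state * A)) traj_prob nu pi h s'.

Definition expect_ret (nu : state -> R) (pi : policy) (t : nat) (F : R -> R) : R :=
  \sum_(h : t.+1.-tuple (state * A)) \sum_(sf : state) traj_prob nu pi h sf * F (ret h sf).

Definition g (nu : state -> R) (t : nat) (pi : policy) (beta : R) : R :=
  if beta == 0 then expect_ret nu pi t id
  else - beta^-1 * ln (expect_ret nu pi t (fun x => expR (- beta * x))).

Definition gstar (nu : state -> R) (t : nat) (beta : R) : R :=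
  sup [set g nu t pi beta | pi in is_HR].

Definition gstar_inf (nu : state -> R) (beta : R) : \bar R :=
  limn_einf (fun t => (gstar nu t beta)%:E).

Definition h (nu : state -> R) (alpha : R) (t : nat) (pi : policy) (beta : R) : R :=
  g nu t pi beta + beta^-1 * ln alpha.

Definition h_inf (nu : state -> R) (alpha : R) (pi : policy) (beta : R) : \bar R :=
  (limn_einf (fun t => (g nu t pi beta)%:E) + (beta^-1 * ln alpha)%:E)%E.

Definition evar (nu : state -> R) (alpha : R) (t : nat) (pi : policy) : R :=
  sup [set h nu alpha t pi beta | beta in `]0, +oo[%classic].

End MDP.

Definition Bgrid (R : realType) (alpha beta0 delta : R) : set R :=
  [set beta | beta = - ln alpha / delta \/
     exists k : nat, let bk := (beta0^-1 + k%:R * delta / ln alpha)^-1 in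
        0 < bk /\ bk < - ln alpha / delta /\ beta = bk].
Arguments SD_policy {R S A} d _ _ _.
Arguments sink {S}.

(* Main.v *)
Require Import Defs.
From HB Require Import structures.
From mathcomp Require Import all_boot all_order all_algebra.
From mathcomp Require Import all_classical all_reals all_analysis.
From mathcomp Require Import ring lra.
Import Order.TTheory GRing.Theory Num.Theory.
Import numFieldNormedType.Exports.
Local Open Scope classical_set_scope.
Local Open Scope ring_scope.

(* Weight each transition by [exp (- beta * reward)]. For a fixed policy, the part
   of [E exp (- beta X_t)] carried by the paths already absorbed is nondecreasing
   in [t], and since the sink is reached within N steps with probability >= 1/2
   under every policy, the remaining part is dominated by increments of the
   absorbed part over N steps. Hence [E exp (- beta X_t)] converges as soon as the
   absorbed part is bounded, and tends to +oo otherwise. The minimal absorbed part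
   over all policies is computed by value iteration; if its limit is finite, the
   greedy stationary policy at the limit attains it. Finally, ERM is nonincreasing
   in beta, so restricting beta to a grid uniform in 1/beta costs at most one
     step;
   the same discretization with an arbitrarily small step shows that EVaR_t
   converges for every policy, without any compactness argument in beta. *)

Lemma sum_tuple_cons {V : nmodType} (T : finType) n (f : seq T -> V) :
  \sum_(h : n.+1.-tuple T) f h = \sum_x \sum_(h : n.-tuple T) f (x :: h).
Proof.
rewrite pair_big /= (reindex (fun q : T * n.-tuple T => [tuple of q.1 ::
  q.2])) /=.
  by [].
exists (fun h : n.+1.-tuple T => (thead h, [tuple of behead h])) => h _ /=.
  by case: h => x h; congr pair; apply: val_inj.
by rewrite -tuple_eta.
Qed.

(** * Trajectory sums and the expectation recursion *)

Section Expectation.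
Context {R : realType} {S : nat} {A : finType}.
Notation state := 'I_S.+1.
Context (p r : state -> A -> state -> R).

(** Rewards are pushed into the argument of [G]; [past] is threaded because the policy may depend on
    the whole history. *)
Fixpoint ev (pi : policy R S A) (n : nat) (past : seq (state * A)) (s : state)
    (G : R -> state -> R) : R :=
  if n is n'.+1 then
    \sum_a pi past s a * \sum_s' p s a s' *
      ev pi n' (rcons past (s, a)) s' (fun x => G (r s a s' + x))
  else G 0 s.

Lemma evS pi n past s G : ev pi n.+1 past s G =
  \sum_a pi past s a * \sum_s' p s a s' *
    ev pi n (rcons past (s, a)) s' (fun x => G (r s a s' + x)).
Proof. by []. Qed.

Lemma eq_ev pi n past s (G H : R -> state -> R) :
  (forall x s', G x s' = H x s') -> ev pi n past s G = ev pi n past s H.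
Proof. by move=> GH; congr ev; apply/funext => x; apply/funext => s'. Qed.

Lemma evZ pi n past s c (G : R -> state -> R) :
  ev pi n past s (fun x s' => c * G x s') = c * ev pi n past s G.
Proof.
elim: n past s G => //= n IH past s G.
rewrite mulr_sumr; apply: eq_bigr => a _.
rewrite mulrCA; congr (_ * _).
rewrite mulr_sumr; apply: eq_bigr => s' _.
by rewrite IH mulrCA.
Qed.

Lemma evD pi n past s (G H : R -> state -> R) :
  ev pi n past s (fun x s' => G x s' + H x s') =
  ev pi n past s G + ev pi n past s H.
Proof.
elim: n past s G H => //= n IH past s G H.
rewrite -big_split /=; apply: eq_bigr => a _.
rewrite -mulrDr; congr (_ * _).
rewrite -big_split /=; apply: eq_bigr => s' _.
by rewrite IH mulrDr.
Qed.

(** [K] also receives the initial state, so that an initial law can be absorbed into it. *)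
Lemma sum_path_w pi n past (K : state -> R -> state -> R) :
  \sum_(h : n.-tuple (state * A)) \sum_sf
    path_w p pi past h sf * K (next_state h sf) (ret r h sf) sf =
  \sum_s ev pi n past s (K s).
Proof.
elim: n past K => [|n IH] past K /=.
  rewrite (big_pred1 [tuple]) => [|h]; last by rewrite [h]tuple0 /= eqxx.
  by apply: eq_bigr => s _; rewrite mul1r.
rewrite (sum_tuple_cons _ _ (fun h => \sum_sf path_w p pi past h sf *
  K (next_state h sf) (ret r h sf) sf)).
rewrite [RHS]pair_bigA; apply: eq_bigr => -[s a] _ /=.
rewrite mulr_sumr.
under [RHS]eq_bigr do rewrite -!evZ.
rewrite -(IH _ (fun s' x sf => pi past s a * (p s a s' * K s (r s a s' + x) sf))).
by apply: eq_bigr => h _; apply: eq_bigr => sf _; ring.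
Qed.

Lemma expect_retE nu pi t F :
  expect_ret p r nu pi t F =
  \sum_s nu s * ev pi t.+1 [::] s (fun x _ => F x).
Proof.
under [RHS]eq_bigr do rewrite -evZ.
rewrite -(sum_path_w pi t.+1 [::] (fun s x _ => nu s * F x)).
by apply: eq_bigr => h _; apply: eq_bigr => sf _; rewrite /traj_prob /=; ring.
Qed.

Lemma state_probE nu pi t s' :
  state_prob p nu pi t s' =
  \sum_s nu s * ev pi t [::] s (fun _ sf => (sf == s')%:R).
Proof.
under [RHS]eq_bigr do rewrite -evZ.
rewrite -(sum_path_w pi t [::] (fun s _ sf => nu s * (sf == s')%:R)).
apply: eq_bigr => h _; rewrite (bigD1 s') //= eqxx big1 ?addr0 => [|sf /negPf ->].
  by rewrite /traj_prob /=; ring.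
by rewrite !mulr0.
Qed.

Definition tilted (b : R) s a s' := p s a s' * expR (- b * r s a s').

(** Feynman-Kac evaluation of the terminal cost [phi]; at [b = 0] it is a plain expectation. *)
Definition tilt_ev b (phi : state -> R) pi n past s : R :=
  ev pi n past s (fun x sf => expR (- b * x) * phi sf).

Lemma tilt_ev0 b phi pi past s : tilt_ev b phi pi 0 past s = phi s.
Proof. by rewrite /tilt_ev /= mulr0 expR0 mul1r. Qed.

(** The exponential turns sums of rewards into products, so the reward moves out of [G] into the
    kernel. *)
Lemma tilt_evS b phi pi n past s :
  tilt_ev b phi pi n.+1 past s =
  \sum_a pi past s a * \sum_s' tilted b s a s' *
    tilt_ev b phi pi n (rcons past (s, a)) s'.
Proof.
rewrite /tilt_ev /=; apply: eq_bigr => a _; congr (_ * _).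
apply: eq_bigr => s' _; rewrite /tilted -mulrA; congr (_ * _); rewrite -evZ.
by apply: eq_ev => x sf; rewrite mulrDr expRD mulrA.
Qed.

Lemma tilt_evD b phi psi pi n past s :
  tilt_ev b (fun s => phi s + psi s) pi n past s =
  tilt_ev b phi pi n past s + tilt_ev b psi pi n past s.
Proof. by rewrite -evD; apply: eq_ev => x sf; rewrite mulrDr. Qed.

Lemma tilt_evZ b c phi pi n past s :
  tilt_ev b (fun s => c * phi s) pi n past s = c * tilt_ev b phi pi n past s.
Proof. by rewrite -evZ; apply: eq_ev => x sf; rewrite mulrCA. Qed.

Lemma tilt_ev_SD b phi d n past s :
  tilt_ev b phi (SD_policy d) n.+1 past s =
  \sum_s' tilted b s (d s) s' *
    tilt_ev b phi (SD_policy d) n (rcons past (s, d s)) s'.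
Proof.
rewrite tilt_evS (bigD1 (d s)) //= {1}/SD_policy eqxx mul1r [X in _ + X]big1
  ?addr0 //.
by move=> a /negPf ad; rewrite /SD_policy ad mul0r.
Qed.

Lemma SD_HR d : is_HR (@SD_policy R S A d).
Proof.
move=> past s; split=> [a|]; first by rewrite /SD_policy; case: ifP.
rewrite (bigD1 (d s)) //= {1}/SD_policy eqxx big1 ?addr0 //.
by move=> a /negPf ad; rewrite /SD_policy ad.
Qed.

Lemma HR_sum_le [pi : policy R S A] (pi_HR : is_HR pi) {past s} {f : A -> R} {y} :
  (forall a, f a <= y) -> \sum_a pi past s a * f a <= y.
Proof.
move=> fy; have [pi0 pi1] := pi_HR past s.
rewrite -[leRHS]mul1r -pi1 mulr_suml; apply: ler_sum => a _.
by rewrite ler_wpM2l.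
Qed.

Lemma HR_sum_ge [pi : policy R S A] (pi_HR : is_HR pi) {past s} {f : A -> R} {y} :
  (forall a, y <= f a) -> y <= \sum_a pi past s a * f a.
Proof.
move=> fy; have [pi0 pi1] := pi_HR past s.
rewrite -[leLHS]mul1r -pi1 mulr_suml; apply: ler_sum => a _.
by rewrite ler_wpM2l.
Qed.

End Expectation.

Arguments ev : simpl never.

(** * Value iteration *)

Lemma cvg_linear_comb {R : realType} {I : finType} (c : I -> R)
    (f : I -> nat -> R) (l : I -> R) :
  (forall i, f i @ \oo --> l i) ->
  (fun n => \sum_i c i * f i n) @ \oo --> \sum_i c i * l i.
Proof.
move=> fl; rewrite -fct_sumE.
apply: (big_ind2 (fun (u : nat -> R) v => u @ \oo --> v)).
- exact: cvg_cst.
- by move=> *; exact: cvgD.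
- by move=> i _; exact: cvgMl_tmp.
Qed.

Section ValueIteration.
Context {R : realType} {T A : finType} (a0 : A).
Context (W : T -> A -> T -> R) (W_ge0 : forall s a s', 0 <= W s a s').

(** [W] has arbitrary row sums: it will be [tilted p r b], both for [b = 0] and for [b > 0]. *)
Definition bellman (x : T -> R) (s : T) : R :=
  let cost a := \sum_s' W s a s' * x s' in cost [arg min_(a < a0) cost a]%O.

Lemma bellman_le x s a : bellman x s <= \sum_s' W s a s' * x s'.
Proof. by rewrite /bellman; case: arg_minP => // i _; apply. Qed.

Lemma bellman_attained x s : exists a, bellman x s = \sum_s' W s a s' * x s'.
Proof. by eexists; reflexivity. Qed.

Lemma le_bellman x y : (forall s, x s <= y s) ->
  forall s, bellman x s <= bellman y s.
Proof.
move=> xy s; have [a ->] := bellman_attained y s.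
apply: le_trans (bellman_le x s a) _.
by apply: ler_sum => s' _; rewrite ler_wpM2l.
Qed.

Context (x0 : T -> R) (x0_le : forall s, x0 s <= bellman x0 s).

Definition value_iter n : T -> R := iter n bellman x0.

Lemma value_iter_nd s : nondecreasing_seq (value_iter ^~ s).
Proof.
apply/nondecreasing_seqP => n.
elim: n s => [|n IH] s; first exact: x0_le.
exact: le_bellman.
Qed.

(** If at some [s] every action gave more than [x s], finiteness of [A] would give one [N] with
    [value_iter N.+1 s > x s], against convergence from below. *)
Lemma value_iter_greedy :
  (forall s, has_ubound (range (value_iter ^~ s))) ->
  exists (x : T -> R) (d : T -> A),
    [/\ forall s, value_iter ^~ s @ \oo --> x s,
        forall n s, value_iter n s <= x s &
        forall s, \sum_s' W s (d s) s' * x s' <= x s].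
Proof.
move=> ub; pose x s := limn (value_iter ^~ s).
have cvg_x s : value_iter ^~ s @ \oo --> x s.
  exact: (nondecreasing_is_cvgn (@value_iter_nd s)).
have le_x n s : value_iter n s <= x s.
  by apply: nondecreasing_cvgn_le; [exact: value_iter_nd|exact: (cvg_x s)].
suff /choice[d dP] : forall s, exists a, \sum_s' W s a s' * x s' <= x s.
  by exists x, d.
move=> s; apply: contrapT => /forallNP no_a.
have lim_a a : \forall n \near \oo, x s < \sum_s' W s a s' * value_iter n s'.
  have cvg_a : (fun n => \sum_s' W s a s' * value_iter n s') @ \oo -->
      \sum_s' W s a s' * x s'.
    exact: cvg_linear_comb.
  apply: (cvgr_gt _ cvg_a); rewrite ltNge; exact/negP.
have [N _ /(_ N (leqnn N)) xN] := filter_forall _ lim_a.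
have [a aE] := bellman_attained (value_iter N) s.
have := xN a; rewrite -aE ltNge => /negP; apply.
exact: (le_x N.+1).
Qed.

End ValueIteration.

(** * Real sequences and the grid *)

(** Bernoulli's inequality for the power [k] of [expR u], obtained from [1 + v <= expR v] at
    [v = (k - 1) * u] and [v = - u]. *)
Lemma bernoulli_expR {R : realType} (k u : R) :
  1 <= k -> 1 + k * (expR u - 1) <= expR (k * u).
Proof.
move=> k1.
have h1 : expR u * (1 + (k * u - u)) <= expR (k * u).
  have -> : expR (k * u) = expR u * expR (k * u - u).
    by rewrite -expRD; congr expR; ring.
  by rewrite ler_pM2l ?expR_gt0 // expR_ge1Dx.
have h2 : expR u * (1 + - u) <= 1.
  by rewrite -[leRHS](expRxMexpNx_1 u) ler_pM2l ?expR_gt0 // expR_ge1Dx.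
have k1_ge0 : 0 <= k - 1 by rewrite subr_ge0.
have := ler_wpM2l k1_ge0 h2; move: h1; lra.
Qed.

Lemma summable_increments {R : realType} (e q : nat -> R) (B : R) :
  e 0%N = 0 -> (forall n, `|e n.+1 - e n| <= q n) ->
  (forall n, \sum_(k < n) q k <= B) ->
  cvgn e /\ forall n, `|e n| <= B.
Proof.
move=> e0 eq qB; have partial n : \sum_(k < n) `|e k.+1 - e k| <= B.
  by apply: le_trans (qB n); apply: ler_sum => k _.
have eE n : e n = \sum_(0 <= k < n) (e k.+1 - e k).
  by rewrite telescope_sumr // e0 subr0.
split=> [|n]; last first.
  by rewrite eE big_mkord; apply: le_trans (ler_norm_sum _ _ _) _.
rewrite (_ : e = series (fun k => e k.+1 - e k)); last exact/funext.
apply: normed_cvg; apply: nondecreasing_is_cvgn.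
  by apply: nondecreasing_series => k _ _; exact: normr_ge0.
exists B => _ [n _ <-]; rewrite -[X in X <= _]/(\sum_(0 <=
  k < n) `|e k.+1 - e k|).
by rewrite big_mkord.
Qed.

(** [U] will be the absorbed part and [V] the surviving one: [V n] lies between 0 and
    [c^-1 * (U (n + N) - U n)], which vanishes once [U] converges. *)
Lemma absorbing_cvg {R : realType} (U V : nat -> R) (N : nat) (c : R) :
  0 < c -> nondecreasing_seq U -> (forall n, 0 <= V n) ->
  (forall n, c * V n + U n <= U (n + N)%N) -> has_ubound (range U) ->
  exists u : R, [/\ U @ \oo --> u, forall n, U n <= u & (fun n =>
    U n + V n) @ \oo --> u].
Proof.
move=> c0 ndU V0 UV ubU; have Uu := nondecreasing_is_cvgn ndU ubU.
exists (limn U); split => // [n|]; first exact: nondecreasing_cvgn_le.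
rewrite -[X in _ --> X]addr0; apply: cvgD => //.
apply: (@squeeze_cvgr _ _ _ _ (fun=> 0) (fun n => c^-1 * (U (n + N)%N - U n))).
- near=> n; rewrite V0 /= ler_pdivlMl //; have := UV n; lra.
- exact: cvg_cst.
- rewrite -[X in _ --> X](mulr0 c^-1); apply: cvgMl_tmp.
  rewrite -(subrr (limn U)); apply: cvgB => //.
  by rewrite (cvg_shiftn N U).
Unshelve. all: by end_near. Qed.

Lemma cvg_neg_ln {R : realType} (b u : R) (f : nat -> R) : 0 < u ->
  f @ \oo --> u -> (fun t => - b^-1 * ln (f t)) @ \oo --> - b^-1 * ln u.
Proof.
move=> u0 fu; apply: cvgMl_tmp; apply: continuous_cvg => //.
exact: continuous_ln.
Qed.

Lemma limn_einf_le {R : realType} (u : nat -> R) (B : R) :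
  (\forall t \near \oo, u t <= B) ->
  (limn_einf (fun t => (u t)%:E) <= B%:E)%E.
Proof.
move=> [N _ uB]; rewrite limn_einf_lim; apply: lime_le; first exact: is_cvg_einfs.
near=> n; apply: (@le_trans _ _ (u (maxn n N))%:E).
  by apply: ereal_inf_lbound; exists (maxn n N) => //=; exact: leq_maxl.
by rewrite lee_fin; apply: uB; exact: leq_maxr.
Unshelve. all: by end_near. Qed.

Lemma limn_einf_ge {R : realType} (u : nat -> R) (B : R) :
  (\forall t \near \oo, B <= u t) ->
  (B%:E <= limn_einf (fun t => (u t)%:E))%E.
Proof.
move=> [N _ uB]; rewrite limn_einf_lim; apply: lime_ge; first exact: is_cvg_einfs.
near=> n; apply: le_ereal_inf_tmp => _ [k nk <-]; rewrite lee_fin; apply: uB.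
by apply: leq_trans nk; near: n; exact: nbhs_infty_ge.
Unshelve. all: by end_near. Qed.

Lemma Bgrid_gt0 {R : realType} (alpha beta0 delta b : R) :
  0 < beta0 -> beta0 < - ln alpha / delta -> Bgrid alpha beta0 delta b -> 0 < b.
Proof.
by move=> b00 b0lt [->|[k [? [_ ->]]] //]; exact: lt_trans b0lt.
Qed.

(* The grid is uniform in [1 / beta], with step [delta / - ln alpha], so
   rounding [beta] down to the grid moves [ln alpha / beta] by at most [delta]. *)
Lemma Bgrid_discretization {R : realType} (alpha beta0 delta : R) :
  alpha < 1 -> 0 < alpha -> 0 < delta -> 0 < beta0 ->
  beta0 < - ln alpha / delta ->
  exists n (c : 'I_n -> R), (forall i, Bgrid alpha beta0 delta (c i)) /\
    forall (G : R -> R) (y : R),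
      (forall b b', 0 < b -> b <= b' -> G b' <= G b) ->
      (forall i, G (c i) + (c i)^-1 * ln alpha <= y) ->
      forall b, beta0 <= b -> G b + b^-1 * ln alpha <= y + delta.
Proof.
move=> a1 a0 d0 b00 b0lt; set bK := - ln alpha / delta in b0lt *.
have lna : ln alpha < 0 by rewrite ln_lt0 // a0.
have bK0 : 0 < bK by exact: lt_trans b0lt.
pose q := delta / - ln alpha.
have q0 : 0 < q by rewrite divr_gt0 // oppr_gt0.
have qE : bK^-1 = q by rewrite /bK invf_div.
have qln : q * ln alpha = - delta by rewrite /q; field; rewrite lt_eqF.
pose c k := (beta0^-1 + k%:R * delta / ln alpha)^-1.
have cE k : (c k)^-1 = beta0^-1 - k%:R * q.
  by rewrite /c invrK /q; field; rewrite lt_eqF // gt_eqF.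
(* For [k >= K] the value [beta0^-1 - k * q] is negative, so every grid point other than [bK] has
   index below [K]. *)
pose K := (Num.truncn (beta0^-1 / q)).+1.
(* Indices whose formula leaves the admissible range default to [bK], itself a grid point; index [K]
   always denotes [bK]. *)
pose gd (i : 'I_K.+1) : R :=
  if (i < K)%N && (0 < c i) && (c i < bK) then c i else bK.
exists K.+1, gd; split=> [i|G y Gni Gy b b0b].
  rewrite /gd; case: ifP => [/andP[/andP[_ ci0] ciK]|_]; last by left.
  by right; exists i.
have bgt0 : 0 < b by exact: lt_le_trans b0b.
(* Beyond [bK] the penalty is at most 0, and at [bK] it equals [- delta]. *)
have [bKb|bbK] := leP bK b.
  have := Gy ord_max; rewrite /gd /= ltnn /= qE qln => GK.
  have : b^-1 * ln alpha <= 0 by rewrite mulr_ge0_le0 ?invr_ge0 ?(ltW bgt0)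
    ?(ltW lna).
  have := Gni _ _ bK0 bKb; lra.
have x_le : b^-1 <= beta0^-1 by rewrite lef_pV2.
have q_lt : q < b^-1 by rewrite -qE ltf_pV2.
have ratio_ge0 : 0 <= (beta0^-1 - b^-1) / q by rewrite divr_ge0 ?subr_ge0 ?(ltW
  q0).
(* [k] counts the whole steps from [beta0^-1] down to [b^-1], so that [c k <= b] and
   [(c k)^-1 - q < b^-1]. *)
have := truncn_itv ratio_ge0; set k := Num.truncn _;
  rewrite ler_pdivlMr // ltr_pdivrMr //.
move=> /andP[k_le k_gt].
have ckV : b^-1 <= (c k)^-1 by rewrite cE; lra.
have ck0 : 0 < c k by rewrite -invr_gt0; apply: lt_le_trans ckV; rewrite invr_gt0.
have ckb : c k <= b by rewrite -lef_pV2.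
have kK : (k < K)%N.
  rewrite -(ltr_nat R); have bq0 : 0 <=
    beta0^-1 / q by rewrite divr_ge0 ?invr_ge0 ?(ltW q0) ?(ltW b00).
  have /andP[_] := truncn_itv bq0; apply: le_lt_trans.
  by rewrite ler_pdivlMr //; apply: le_trans k_le _; rewrite gerBl invr_ge0 ltW.
have := Gy (Ordinal (ltnW kK : (k < K.+1)%N)).
rewrite /gd /= kK ck0 (le_lt_trans ckb bbK) /= => Gck.
have := Gni _ _ ck0 ckb.
have : b^-1 * ln alpha <= ((c k)^-1 - q) * ln alpha.
  by rewrite ler_wnM2r ?(ltW lna) //; move: k_gt; rewrite cE -natr1; lra.
rewrite mulrBl qln; lra.
Qed.

(** * Transient decision processes *)

Section MDPTheory.
Context {R : realType} {S : nat} {A : finType}.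
Notation state := 'I_S.+1.
Context {p r : state -> A -> state -> R}.
Context (p_ge0 : forall s a s', 0 <= p s a s').
Context (p_sum1 : forall s a, \sum_(s' : state) p s a s' = 1).
Context (p_sink : forall a, p sink a sink = 1).
Context (r_sink : forall a, r sink a sink = 0).

Lemma tilted_ge0 b s a s' : 0 <= tilted p r b s a s'.
Proof. by rewrite mulr_ge0 ?expR_ge0. Qed.

Lemma tilted0 s a s' : tilted p r 0 s a s' = p s a s'.
Proof. by rewrite /tilted oppr0 mul0r expR0 mulr1. Qed.

Lemma p_sink0 a s : s != sink -> p sink a s = 0.
Proof.
move=> ss; have := p_sum1 sink a; rewrite (bigD1 sink) //= p_sink.
move/eqP; rewrite -[eqbRHS]addr0 (inj_eq (addrI 1)) psumr_eq0 // => /allP/(_ s).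
by rewrite mem_index_enum ss => /(_ isT)/eqP.
Qed.

Lemma sum_tilted_sink b a (f : state -> R) :
  \sum_s' tilted p r b sink a s' * f s' = f sink.
Proof.
rewrite (bigD1 sink) //= {1}/tilted p_sink r_sink mulr0 expR0 !mul1r.
by rewrite big1 ?addr0 // => s ss; rewrite /tilted p_sink0 // !mul0r.
Qed.

Lemma ge_tilted_sink b s a :
  (s == sink)%:R <= \sum_s' tilted p r b s a s' * (s' == sink)%:R.
Proof.
have [->|_] := eqVneq s sink; first by rewrite sum_tilted_sink eqxx.
by apply: sumr_ge0 => s' _; rewrite mulr_ge0 ?tilted_ge0.
Qed.

(** * Comparison principles valid for all policies *)

Section FixedPolicy.
Context { pi : policy R S A} (pi_HR : is_HR pi).

(** A one-step bound that holds for every action survives averaging by any randomized,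
    history-dependent choice. *)
Lemma tilt_ev_ge b phi (x : nat -> state -> R) :
  (forall s, x 0%N s <= phi s) ->
  (forall n s a, x n.+1 s <= \sum_s' tilted p r b s a s' * x n s') ->
  forall n past s, x n s <= tilt_ev p r b phi pi n past s.
Proof.
move=> x0 xS; elim=> [|n IH] past s; first by rewrite tilt_ev0.
rewrite tilt_evS; apply: (HR_sum_ge pi_HR) => a; apply: le_trans (xS n s a) _.
by apply: ler_sum => s' _; rewrite ler_wpM2l ?tilted_ge0.
Qed.

Lemma tilt_ev_le b phi (x : nat -> state -> R) :
  (forall s, phi s <= x 0%N s) ->
  (forall n s a, \sum_s' tilted p r b s a s' * x n s' <= x n.+1 s) ->
  forall n past s, tilt_ev p r b phi pi n past s <= x n s.
Proof.
move=> x0 xS; elim=> [|n IH] past s; first by rewrite tilt_ev0.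
rewrite tilt_evS; apply: (HR_sum_le pi_HR) => a; apply: le_trans _ (xS n s a).
by apply: ler_sum => s' _; rewrite ler_wpM2l ?tilted_ge0.
Qed.

Lemma tilt_ev_ge0 b phi n past s : (forall s, 0 <= phi s) ->
  0 <= tilt_ev p r b phi pi n past s.
Proof.
move=> phi0; apply: (tilt_ev_ge b phi (fun _ _ => 0)) => // {}n {}s a.
by apply: sumr_ge0 => s' _; rewrite mulr0.
Qed.

(** The terminal cost at time [n] is replaced by [N] further steps. The hypothesis ranges over all
    pasts because the policy continues from the history reached. *)
Lemma le_tilt_ev_add b phi psi N :
  (forall past s, phi s <= tilt_ev p r b psi pi N past s) ->
  forall n past s,
    tilt_ev p r b phi pi n past s <= tilt_ev p r b psi pi (n + N) past s.
Proof.
move=> le_phi; elim=> [|n IH] past s; first by rewrite tilt_ev0.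
rewrite addSn !tilt_evS; have [pi0 _] := pi_HR past s.
apply: ler_sum => a _; rewrite ler_wpM2l //; apply: ler_sum => s' _.
by rewrite ler_wpM2l ?tilted_ge0.
Qed.

Lemma absorbed_ge b n past s :
  (s == sink)%:R <= tilt_ev p r b (fun s => (s == sink)%:R) pi n past s.
Proof.
by apply: (tilt_ev_ge b _ (fun _ s => (s == sink)%:R)) => // *;
  exact: ge_tilted_sink.
Qed.

(** An absorbed path keeps its weight, since the sink pays nothing. *)
Lemma absorbed_nd b past s :
  nondecreasing_seq (fun n =>
    tilt_ev p r b (fun s => (s == sink)%:R) pi n past s).
Proof.
apply/nondecreasing_seqP => n; rewrite -(addn1 n).
by apply: le_tilt_ev_add => *; exact: absorbed_ge.
Qed.

End FixedPolicy.

Lemma tilt_ev_SD_le b phi d (x : state -> R) :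
  (forall s, phi s <= x s) ->
  (forall s, \sum_s' tilted p r b s (d s) s' * x s' <= x s) ->
  forall n past s, tilt_ev p r b phi (SD_policy d) n past s <= x s.
Proof.
move=> x0 xS; elim=> [|n IH] past s; first by rewrite tilt_ev0.
rewrite tilt_ev_SD; apply: le_trans (xS s).
by apply: ler_sum => s' _; rewrite ler_wpM2l ?tilted_ge0.
Qed.

Lemma tilt_ev_sum b (I : finType) (c : I -> R) phi pi n past s :
  tilt_ev p r b (fun s => \sum_i c i * phi i s) pi n past s =
  \sum_i c i * tilt_ev p r b (phi i) pi n past s.
Proof.
elim: (index_enum I) => [|i e IH].
  rewrite big_nil -[RHS](mul0r (tilt_ev p r b (fun=> 0) pi n past s)).
  by rewrite -tilt_evZ; apply: eq_ev => x s'; rewrite big_nil mul0r.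
rewrite big_cons -IH -tilt_evZ -tilt_evD.
by apply: eq_ev => x s'; rewrite big_cons.
Qed.

(** * Uniform transience and a Lyapunov function *)

Context (a0 : A).
Context (transient : forall (d : state -> A) (s s' : state),
  s != sink -> s' != sink ->
  cvgn (series (fun t => state_prob p (fun x => if x == s then 1 else 0)
                                    (SD_policy d) t s'))).

(* [- survival n s] is the largest probability, over all policies, of not having
   reached the sink after [n] steps from [s]. *)
Definition survival : nat -> state -> R :=
  value_iter a0 (tilted p r 0) (fun s => - (s != sink)%:R).

Lemma survival_init s :
  - (s != sink)%:R <= bellman a0 (tilted p r 0) (fun s => - (s != sink)%:R) s.
Proof.
have [a ->] := bellman_attained a0 (tilted p r 0) (fun s => - (s != sink)%:R) s.
have [->|sn] := eqVneq s sink; first by rewrite sum_tilted_sink eqxx.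
apply: (@le_trans _ _ (- \sum_s' p s a s')); first by rewrite p_sum1.
rewrite -sumrN; apply: ler_sum => s' _.
rewrite tilted0 mulrN lerN2 -[leRHS]mulr1 ler_wpM2l //.
by case: (s' != sink).
Qed.

Lemma survival_step n s a :
  survival n.+1 s <= \sum_s' p s a s' * survival n s'.
Proof.
apply: le_trans (bellman_le a0 (tilted p r 0) (survival n) s a) _.
by apply: ler_sum => s' _; rewrite tilted0.
Qed.

Lemma survival_ge n s : - (s != sink)%:R <= survival n s.
Proof. exact: (value_iter_nd a0 _ (tilted_ge0 0) _ survival_init s 0%N n). Qed.

Lemma survival_le0 n s : survival n s <= 0.
Proof.
elim: n s => [|n IH] s; first by rewrite oppr_le0.
apply: le_trans (survival_step n s a0) _.
by apply: sumr_le0 => s' _; rewrite mulr_ge0_le0.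
Qed.

Lemma survival_sink n : survival n sink = 0.
Proof.
apply/eqP; rewrite eq_le survival_le0 /=.
by have := survival_ge n sink; rewrite eqxx oppr0.
Qed.

(** Survival is the sum, over finitely many non-sink states, of terms of convergent occupation
    series, and these terms tend to 0. *)
Lemma SD_survival d s : s != sink ->
  (fun n => tilt_ev p r 0 (fun s => - (s != sink)%:R) (SD_policy d) n [::] s)
    @ \oo --> 0.
Proof.
move=> sn.
have occ s' n : state_prob p (fun x =>
  if x == s then 1 else 0) (SD_policy d) n s' =
    tilt_ev p r 0 (fun sf => (sf == s')%:R) (SD_policy d) n [::] s.
  rewrite (state_probE p r) (bigD1 s) //= eqxx mul1r big1 => [|i /negPf->];
    last by rewrite mul0r.
  by rewrite addr0; apply: eq_ev => x sf; rewrite oppr0 mul0r expR0 mul1r.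
pose f s' n := (s' != sink)%:R *
  tilt_ev p r 0 (fun sf => (sf == s')%:R) (SD_policy d) n [::] s.
have f0 s' : f s' @ \oo --> 0.
  have [s'n|s'n] := boolP (s' == sink).
    by rewrite /f s'n /=; under eq_fun do rewrite mul0r; exact: cvg_cst.
  rewrite /f s'n; under eq_fun do rewrite mul1r -occ.
  exact: cvg_series_cvg_0 (transient d s s' sn s'n).
have := cvg_linear_comb (fun=> -1) f (fun=> 0) f0.
rewrite big1 => [|i _]; last by rewrite mulr0.
apply: cvg_trans; apply: near_eq_cvg; near=> n.
rewrite -[LHS]/(\sum_s' -1 * f s' n).
under eq_bigr do rewrite /f mulrA.
rewrite -tilt_ev_sum; apply: eq_ev => x sf; congr (_ * _).
rewrite (bigD1 sf) //= eqxx mulr1 mulN1r big1 ?addr0 // => i /negPf isf.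
by rewrite [sf == i]eq_sym isf mulr0.
Unshelve. all: by end_near. Qed.

(** Upgrades transience of stationary deterministic policies to a horizon common to all policies.
    For the greedy [d] at the limit [x], minus the survival probability of [d] is at most [x];
    transience of [d] forces [x >= 0], and finitely many states share one [N]. *)
Lemma uniform_transience : exists N, forall s, - 2^-1 <= survival N s.
Proof.
have ub s : has_ubound (range (survival ^~ s)).
  by exists 0 => _ [n _ <-]; exact: survival_le0.
have [x [d [cvg_x le_x xd]]] :=
  value_iter_greedy a0 _ (tilted_ge0 0) _ survival_init ub.
have x_ge0 s : 0 <= x s.
  have [->|sn] := eqVneq s sink.
    by have := le_x 0%N sink; rewrite /value_iter /= eqxx oppr0.
  have lim0 := SD_survival d s sn.
  rewrite -(cvg_lim _ lim0) //; apply: limr_le; first by apply: cvgP lim0.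
  by near=> n; apply: tilt_ev_SD_le => // s'; exact: (le_x 0%N).
have [|N _ /(_ N (leqnn N)) hN] :=
  @filter_forall _ _ (fun s n => - 2^-1 <= survival n s) \oo _.
  move=> s; apply: (cvgr_ge _ (cvg_x s)); apply: lt_le_trans (x_ge0 s).
  by rewrite oppr_lt0 invr_gt0.
by exists N.
Unshelve. all: by end_near. Qed.

(** [L] is twice the sum of the worst-case survival probabilities up to [N]. A transition shifts
    that sum by one index; off the sink it drops by at least [1 + survival N s >= 1/2], and the
    factor 2 makes this 1. *)
Lemma lyapunov : exists L : state -> R,
  [/\ forall s, 0 <= L s, L sink = 0 &
      forall s a, \sum_s' p s a s' * L s' <= L s - (s != sink)%:R].
Proof.
have [N hN] := uniform_transience.
exists (fun s => - 2 * \sum_(k < N) survival k s); split=> [s||s a].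
- by rewrite mulNr oppr_ge0 mulr_ge0_le0 // sumr_le0 // => k _;
    exact: survival_le0.
- by rewrite big1 ?mulr0 // => k _; exact: survival_sink.
- have [->|sn] := eqVneq s sink.
    under eq_bigr do rewrite -tilted0.
    by rewrite sum_tilted_sink subr0.
  have -> : \sum_s' p s a s' * (- 2 * \sum_(k < N) survival k s') =
      - 2 * \sum_(k < N) \sum_s' p s a s' * survival k s'.
    rewrite exchange_big /= mulr_sumr; apply: eq_bigr => s' _.
    by rewrite mulrCA mulr_sumr.
  have : \sum_(k < N) survival k.+1 s <=
      \sum_(k < N) \sum_s' p s a s' * survival k s'.
    by apply: ler_sum => k _; exact: survival_step.
  have : \sum_(k < N) (survival k.+1 s - survival k s) = survival N s + 1.
    rewrite -(big_mkord xpredT (fun k => survival k.+1 s - survival k s)).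
    by rewrite telescope_sumr // /survival /value_iter /= sn opprK.
  rewrite sumrB -[(~~ false)%:R]/(1 : R).
  have := hN s; lra.
Qed.

Context (M : R) (M_gt0 : 0 < M) (r_le : forall s a s', `|r s a s'| <= M).

(** [1 + survival n s] is the least probability of absorption within [n] steps, and each step has
    weight at least [expR (- (b * M))]. *)
Lemma absorbed_ge_survival b pi n past s : 0 <= b -> is_HR pi ->
  expR (- (b * M) * n%:R) * (1 + survival n s) <=
  tilt_ev p r b (fun s => (s == sink)%:R) pi n past s.
Proof.
move=> b0 pi_HR.
apply: (tilt_ev_ge pi_HR b _ (fun n s =>
  expR (- (b * M) * n%:R) * (1 + survival n s)))
  => [{}s|{}n {}s a].
  rewrite mulr0 expR0 mul1r /survival /value_iter /=.
  by case: (s == sink); rewrite /= ?oppr0 ?addr0 // subrr.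
have -> : expR (- (b * M) * n.+1%:R) = expR (- (b * M) * n%:R) * expR (- (b * M)).
  by rewrite -expRD -natr1; congr expR; ring.
apply: (@le_trans _ _ (expR (- (b * M) * n%:R) * (expR (- (b * M)) *
    \sum_s' p s a s' * (1 + survival n s')))).
  rewrite -mulrA !ler_pM2l ?expR_gt0 //.
  under eq_bigr do rewrite mulrDr mulr1.
  by rewrite big_split /= p_sum1 lerD2l survival_step.
rewrite 2!mulr_sumr; apply: ler_sum => s' _.
have s1 : 0 <= 1 + survival n s'.
  have := survival_ge n s'; case: (s' != sink) => /=; lra.
rewrite /tilted.
have : expR (- (b * M)) <= expR (- b * r s a s').
  rewrite ler_expR mulNr lerN2 ler_wpM2l //.
  by apply: le_trans (ler_norm _) _.
move=> /(ler_wpM2l (mulr_ge0 (p_ge0 s a s') (mulr_ge0 (expR_ge0 (- (b * M) *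
  n%:R)) s1))).
by congr (_ <= _); ring.
Qed.

Lemma le_ev pi n past s (G H : R -> state -> R) : is_HR pi ->
  (forall x s', G x s' <= H x s') -> ev p r pi n past s G <= ev p r pi n past s H.
Proof.
move=> pi_HR; elim: n past s G H => [|n IH] past s G H GH; first exact: GH.
rewrite !evS.
have [pi0 _] := pi_HR past s.
apply: ler_sum => a _; rewrite ler_wpM2l //; apply: ler_sum => s' _.
by rewrite ler_wpM2l // IH.
Qed.

Lemma ev_cst pi n past s c : is_HR pi -> ev p r pi n past s (fun _ _ => c) = c.
Proof.
move=> pi_HR; elim: n past s => [//|n IH] past s; rewrite !evS.
under eq_bigr do under eq_bigr do rewrite IH.
under eq_bigr do rewrite -mulr_suml p_sum1 mul1r.
by rewrite -mulr_suml (pi_HR past s).2 mul1r.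
Qed.

Context {mu : state -> R}.
Context (mu_sink : mu sink = 0) (mu_pos : forall s, s != sink -> 0 < mu s).
Context (mu_sum1 : \sum_s mu s = 1).

Lemma mu_ge0 s : 0 <= mu s.
Proof.
by have [->|/mu_pos/ltW//] := eqVneq s sink; rewrite mu_sink.
Qed.

Lemma le_mu_mean (f g : state -> R) : (forall s, f s <= g s) ->
  \sum_s mu s * f s <= \sum_s mu s * g s.
Proof. by move=> fg; apply: ler_sum => s _; rewrite ler_wpM2l ?mu_ge0. Qed.

Lemma mu_mean_cst c : \sum_s mu s * c = c.
Proof. by rewrite -mulr_suml mu_sum1 mul1r. Qed.

(** * Entropic risk at a finite horizon *)

Section Expectations.
Context { pi : policy R S A} (pi_HR : is_HR pi).

Lemma le_expect_ret t (F G : R -> R) : (forall x, F x <= G x) ->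
  expect_ret p r mu pi t F <= expect_ret p r mu pi t G.
Proof.
by move=> FG; rewrite !expect_retE; apply: le_mu_mean => s; exact: le_ev.
Qed.

Lemma expect_ret_affine t (a c : R) (F : R -> R) :
  expect_ret p r mu pi t (fun x =>
    a + c * F x) = a + c * expect_ret p r mu pi t F.
Proof.
rewrite !expect_retE mulr_sumr -[X in X + _](mu_mean_cst a) -big_split /=.
apply: eq_bigr => s _.
rewrite mulrCA -mulrDr; congr (_ * _).
apply: etrans (evD p r pi _ _ _ (fun _ _ => a) (fun x _ => c * F x)) _.
by rewrite ev_cst //; congr (_ + _); exact: evZ.
Qed.

(** Integrates the tangent line of [expR (- b * x)] at the mean. *)
Lemma jensen_expR t b :
  expR (- b * g p r mu t pi 0) <= expect_ret p r mu pi t (fun x =>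
    expR (- b * x)).
Proof.
rewrite /g eqxx; set m := expect_ret p r mu pi t id.
have -> : expR (- b * m) = expect_ret p r mu pi t
    (fun x => expR (- b * m) * (1 + b * m) + expR (- b * m) * - b * id x).
  by rewrite expect_ret_affine -/m; ring.
apply: le_expect_ret => x /=.
have -> : - b * x = - b * m + - b * (x - m) by ring.
rewrite expRD -mulrA -mulrDr ler_pM2l ?expR_gt0 //.
have -> : 1 + b * m + - b * x = 1 + - b * (x - m) by ring.
exact: expR_ge1Dx.
Qed.

Lemma exp_moment_gt0 t b : 0 < expect_ret p r mu pi t (fun x => expR (- b * x)).
Proof. by apply: lt_le_trans (jensen_expR t b); exact: expR_gt0. Qed.

Lemma g_le t (b y : R) : 0 < b -> 0 < y ->
  y <= expect_ret p r mu pi t (fun x => expR (- b * x)) ->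
  g p r mu t pi b <= - b^-1 * ln y.
Proof.
move=> b0 y0 le_y; rewrite /g gt_eqF // ler_wnM2l ?oppr_le0 ?invr_ge0 ?(ltW b0)
  //.
by rewrite ler_ln ?posrE // exp_moment_gt0.
Qed.

Lemma g_ge t (b y : R) : 0 < b -> 0 < y ->
  expect_ret p r mu pi t (fun x => expR (- b * x)) <= y ->
  - b^-1 * ln y <= g p r mu t pi b.
Proof.
move=> b0 y0 le_y; rewrite /g gt_eqF // ler_wnM2l ?oppr_le0 ?invr_ge0 ?(ltW b0)
  //.
by rewrite ler_ln ?posrE // exp_moment_gt0.
Qed.

(** For [b = 0] this is Jensen. Otherwise let [m] be the ERM at [b] and [b' = k * b]:
    [expR (- b * (X - m))] has mean 1, so by Bernoulli its power [k] has mean at least 1. *)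
Lemma g_nonincreasing t (b b' : R) : 0 <= b -> b <= b' ->
  g p r mu t pi b' <= g p r mu t pi b.
Proof.
rewrite le_eqVlt => /predU1P[<-|b0].
  rewrite le_eqVlt => /predU1P[<- //|b'0].
  apply: le_trans (g_le t b' _ b'0 (expR_gt0 _) (jensen_expR t b')) _.
  by rewrite expRK mulrA mulrNN mulVf ?mul1r ?gt_eqF.
move=> bb'; have b'0 : 0 < b' by exact: lt_le_trans bb'.
set m := g p r mu t pi b.
have Em : expect_ret p r mu pi t (fun x => expR (- b * x)) = expR (- b * m).
  rewrite /m /g gt_eqF // mulrA mulrNN mulfV ?gt_eqF // mul1r lnK //.
  by rewrite posrE exp_moment_gt0.
suff le_m : expR (- b' * m) <= expect_ret p r mu pi t (fun x => expR (- b' * x)).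
  apply: le_trans (g_le t b' _ b'0 (expR_gt0 _) le_m) _.
  by rewrite expRK mulrA mulrNN mulVf ?mul1r ?gt_eqF.
have [k k1 kE] : exists2 k : R, 1 <= k & b' = k * b.
  by exists (b' / b); rewrite ?ler_pdivlMr ?mul1r // divfK ?gt_eqF.
have -> : expR (- b' * m) = expect_ret p r mu pi t (fun x =>
    expR (- b' * m) * (1 - k) + expR (- b' * m) * k * expR (b * m) * expR (- b
      * x)).
  have e1 : expR (b * m) * expR (- b * m) = 1 by rewrite -expRD mulNr subrr expR0.
  by rewrite expect_ret_affine Em -[_ * _ * expR (- b * m)]mulrA e1; ring.
apply: le_expect_ret => x.
have -> : - b' * x = - b' * m + k * (- b * (x - m)).
  by rewrite kE; ring.
rewrite expRD -!mulrA -mulrDr ler_pM2l ?expR_gt0 //.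
have -> : expR (b * m) * expR (- b * x) = expR (- b * (x - m)).
  by rewrite -expRD; congr expR; ring.
have -> : 1 - k + k * expR (- b * (x - m)) =
    1 + k * (expR (- b * (x - m)) - 1) by ring.
exact: bernoulli_expR.
Qed.

End Expectations.

(** * Expected returns and small risk levels *)

Lemma mean_increment pi n past s : is_HR pi ->
  `|ev p r pi n.+1 past s (fun x _ => x) - ev p r pi n past s (fun x _ => x)|
    <= M * tilt_ev p r 0 (fun s => (s != sink)%:R) pi n past s.
Proof.
(* Pulled out of [ev], the first reward cancels between the two horizons; by induction only the last
   reward remains, which is 0 from the sink and at most [M] in norm elsewhere. *)
move=> pi_HR; have step k h s' : ev p r pi k.+1 h s' (fun x _ => x) =
    \sum_a pi h s' a * \sum_s'' p s' a s'' *
      (r s' a s'' + ev p r pi k (rcons h (s', a)) s'' (fun x _ => x)).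
  rewrite evS; apply: eq_bigr => a _; congr (_ * _); apply: eq_bigr => s'' _.
  congr (_ * _); apply: etrans (evD p r pi _ _ _ (fun _ _ =>
    r s' a s'') (fun x _ => x)) _.
  by rewrite ev_cst.
elim: n past s => [|n IH] past s.
  rewrite step [ev p r pi 0 past s _]/(0 : R) subr0 tilt_ev0.
  have [->|sn] := eqVneq s sink.
    rewrite big1 ?normr0 ?mulr0 // => a _; rewrite (bigD1 sink) //= r_sink.
    rewrite [ev p r pi 0 _ _ _]/(0 : R) addr0 mulr0 add0r big1 ?mulr0 // => s' ss.
    by rewrite p_sink0 // mul0r.
  have [pi0 _] := pi_HR past s; rewrite mulr1.
  apply: le_trans (ler_norm_sum _ _ _) _.
  have le_a a : `|\sum_s' p s a s' * (r s a s' +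
      ev p r pi 0 (rcons past (s, a)) s' (fun x _ => x))| <= M.
    apply: le_trans (ler_norm_sum _ _ _) _.
    rewrite -[leRHS]mul1r -(p_sum1 s a) mulr_suml; apply: ler_sum => s' _.
    rewrite [ev p r pi 0 _ _ _]/(0 : R) addr0 normrM ger0_norm //.
    by rewrite ler_wpM2l.
  apply: le_trans _ (HR_sum_le pi_HR le_a).
  by apply: ler_sum => a _; rewrite normrM ger0_norm.
rewrite !step tilt_evS -sumrB mulr_sumr.
apply: le_trans (ler_norm_sum _ _ _) _; apply: ler_sum => a _.
have [pi0 _] := pi_HR past s.
rewrite -mulrBr normrM ger0_norm // [leRHS]mulrCA ler_wpM2l //.
rewrite -sumrB mulr_sumr.
apply: le_trans (ler_norm_sum _ _ _) _; apply: ler_sum => s' _.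
rewrite -mulrBr normrM ger0_norm // tilted0 [leRHS]mulrCA ler_wpM2l //.
by rewrite opprD addrACA subrr add0r.
Qed.

(** Each step before absorption consumes one unit of [L], which stays nonnegative. *)
Lemma occupation_le (L : state -> R) pi n past s : is_HR pi ->
  (forall s, 0 <= L s) ->
  (forall s a, \sum_s' p s a s' * L s' <= L s - (s != sink)%:R) ->
  \sum_(k < n) tilt_ev p r 0 (fun s => (s != sink)%:R) pi k past s <= L s.
Proof.
move=> pi_HR L0 LS; elim: n past s => [|n IH] past s; first by rewrite big_ord0.
rewrite big_ord_recl tilt_ev0 -lerBrDl.
under eq_bigr do rewrite lift0 tilt_evS.
rewrite exchange_big /=; under eq_bigr do rewrite -mulr_sumr.
apply: (HR_sum_le pi_HR) => a; apply: le_trans _ (LS s a).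
rewrite exchange_big /=; apply: ler_sum => s' _.
by rewrite -mulr_sumr tilted0 ler_wpM2l.
Qed.

(** Increments are summable by the Lyapunov bound. [C] is independent of [pi], so that the supremum
    in [gstar] at 0 is over a bounded set. *)
Lemma mean_cvg : exists C : R, forall pi, is_HR pi ->
  cvgn (fun t => g p r mu t pi 0) /\ forall t, g p r mu t pi 0 <= C.
Proof.
have [L [L0 _ LS]] := lyapunov.
exists (\sum_s mu s * (M * L s)) => pi pi_HR.
have mean s : cvgn (fun n => ev p r pi n [::] s (fun x _ => x)) /\
    forall n, `|ev p r pi n [::] s (fun x _ => x)| <= M * L s.
  apply: (summable_increments _
    (fun n => M * tilt_ev p r 0 (fun s => (s != sink)%:R) pi n [::] s)).
  - by [].
  - by move=> n; exact: mean_increment.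
  - by move=> n; rewrite -mulr_sumr ler_pM2l // occupation_le.
have gE t : g p r mu t pi 0 = \sum_s mu s * ev p r pi t.+1 [::] s (fun x _ => x).
  by rewrite /g eqxx expect_retE.
split=> [|t]; last first.
  rewrite gE; apply: le_mu_mean => s.
  by apply: le_trans (ler_norm _) _; exact: (mean s).2.
under eq_fun do rewrite gE.
apply/cvg_ex; exists (\sum_s mu s * limn (fun t =>
  ev p r pi t [::] s (fun x _ => x))).
apply: (cvg_linear_comb mu
  (fun s t => ev p r pi t.+1 [::] s (fun x _ => x))) => s.
by have /= := (mean s).1; rewrite -(cvg_shiftS (fun t =>
  ev p r pi t [::] s (fun x _ => x))).
Qed.

(** For small [b], [1 + L] is a super-solution of the tilted recursion: off the sink the drift
    leaves [expR (b * M) * L s <= (1 + K^-1) * L s <= 1 + L s], as [L <= K]. This later provides a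
    level at which ERM stays bounded below. *)
Lemma small_exp_moment : exists b1 B : R, 0 < b1 /\
  forall b pi t, is_HR pi -> 0 < b -> b <= b1 ->
    expect_ret p r mu pi t (fun x => expR (- b * x)) <= B.
Proof.
have [L [L0 Ls LS]] := lyapunov.
pose K := 1 + \sum_s L s.
have K_gt0 : 0 < K by rewrite ltr_pwDl // sumr_ge0.
have LK s : L s <= K.
  by rewrite /K (bigD1 s) //= addrCA lerDl addr_ge0 // sumr_ge0.
have K1 : 1 < 1 + K^-1 by rewrite ltrDl invr_gt0.
exists (ln (1 + K^-1) / M), (\sum_s mu s * (1 + L s)); split.
  by rewrite divr_gt0 // ln_gt0.
move=> b pi t pi_HR b0; rewrite ler_pdivlMr // => bM.
have ebM : expR (b * M) <= 1 + K^-1.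
  by rewrite -[leRHS]lnK ?posrE ?(lt_trans ltr01) // ler_expR.
rewrite expect_retE; apply: le_mu_mean => s.
have -> : ev p r pi t.+1 [::] s (fun x _ => expR (- b * x)) =
    tilt_ev p r b (fun=> 1) pi t.+1 [::] s.
  by apply: eq_ev => x s'; rewrite mulr1.
apply: (tilt_ev_le pi_HR b _ (fun _ s => 1 + L s)) => [{}s|_ {}s a].
  by rewrite lerDl.
have [->|sn] := eqVneq s sink; first by rewrite sum_tilted_sink.
apply: (@le_trans _ _ (expR (b * M) * \sum_s' p s a s' * (1 + L s'))).
  rewrite mulr_sumr; apply: ler_sum => s' _.
  rewrite /tilted -mulrA mulrCA ler_wpM2r //.
    by rewrite mulr_ge0 // addr_ge0.
  rewrite ler_expR mulNr -mulrN ler_wpM2l ?(ltW b0) //.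
  by apply: le_trans (ler_norm _) _; rewrite normrN.
under eq_bigr do rewrite mulrDr mulr1.
rewrite big_split /= p_sum1.
have /(ler_wpM2l (expR_ge0 (b * M))) : 1 + \sum_s' p s a s' * L s' <= L s.
  by have := LS s a; rewrite sn /=; lra.
move/le_trans; apply; apply: le_trans (ler_wpM2r (L0 s) ebM) _.
by rewrite mulrDl mul1r addrC lerD2r ler_pdivrMl // mulr1.
Qed.

(** * Exponential moments at a fixed positive level *)

Section ExponentialMoment.
Context (b : R) (b_gt0 : 0 < b).

Let absorbed pi n past s := tilt_ev p r b (fun s => (s == sink)%:R) pi n past s.
Let survivor pi n past s := tilt_ev p r b (fun s => (s != sink)%:R) pi n past s.
Let moment pi t := expect_ret p r mu pi t (fun x => expR (- b * x)).

Lemma exp_moment_split pi t : moment pi t =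
  \sum_s mu s * absorbed pi t.+1 [::] s + \sum_s mu s * survivor pi t.+1 [::] s.
Proof.
rewrite /moment expect_retE -big_split /=; apply: eq_bigr => s _.
rewrite -mulrDr -tilt_evD; congr (_ * _); apply: eq_ev => x s'.
by case: (s' == sink); rewrite /= ?addr0 ?add0r mulr1.
Qed.

Lemma exp_moment_ge pi t : is_HR pi ->
  \sum_s mu s * absorbed pi t.+1 [::] s <= moment pi t.
Proof.
move=> pi_HR; rewrite exp_moment_split lerDl sumr_ge0 // => s _.
by rewrite mulr_ge0 ?mu_ge0 // tilt_ev_ge0.
Qed.

(** Within [N] steps absorption has probability at least 1/2, on paths of weight at least
    [expR (- (b * M) * N%:R)]; hence surviving mass feeds at least a fraction [c] of itself into the
    absorbed part. *)
Lemma survivor_le : exists N (c : R), [/\ 0 < c,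
  forall pi past s, is_HR pi -> c <= absorbed pi N past s &
  forall pi n past s, is_HR pi ->
    c * survivor pi n past s + absorbed pi n past s <=
      absorbed pi (n + N) past s].
Proof.
have [N hN] := uniform_transience.
exists N, (expR (- (b * M) * N%:R) / 2).
have c0 : 0 < expR (- (b * M) * N%:R) / 2 by rewrite divr_gt0 ?expR_gt0.
have cN pi past s : is_HR pi -> expR (- (b * M) * N%:R) / 2 <=
  absorbed pi N past s.
  move=> pi_HR; apply: le_trans (absorbed_ge_survival b pi N past s (ltW b_gt0)
    pi_HR).
  by rewrite ler_pM2l ?expR_gt0 //; have := hN s; lra.
split => // pi n past s pi_HR.
rewrite /survivor -tilt_evZ -tilt_evD; apply: le_tilt_ev_add => // h s'.
have [->|_] := eqVneq s' sink; last by rewrite mulr1 addr0 cN.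
by rewrite mulr0 add0r; have := absorbed_ge pi_HR b N h sink; rewrite eqxx.
Qed.

(** By the last clause survivors do not contribute to the limit: bounding the absorbed part bounds
    [u]. *)
Lemma exp_moment_cvg pi : is_HR pi ->
  has_ubound (range (fun t => \sum_s mu s * absorbed pi t.+1 [::] s)) ->
  exists u : R, [/\ 0 < u, moment pi @ \oo --> u &
    forall y, (forall t, \sum_s mu s * absorbed pi t.+1 [::] s <= y) -> u <= y].
Proof.
move=> pi_HR; set U := fun t => _ => ub.
have [N [c [c0 cN cV]]] := survivor_le.
have ndU : nondecreasing_seq U.
  apply/nondecreasing_seqP => t; apply: le_mu_mean => s.
  exact: (absorbed_nd pi_HR b [::] s t.+1 t.+2 (leqnSn _)).
have [||u [Uu le_u UVu]] :=
    absorbing_cvg U (fun t => \sum_s mu s * survivor pi t.+1 [::] s) N c c0 ndU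
      _ _ ub.
- by move=> t; apply: sumr_ge0 => s _; rewrite mulr_ge0 ?mu_ge0 ?tilt_ev_ge0.
- move=> t; rewrite mulr_sumr -big_split /=; apply: ler_sum => s _.
  by rewrite mulrCA -mulrDr ler_wpM2l ?mu_ge0 // cV.
exists u; split.
- apply: (lt_le_trans _ (le_u N)); apply: (lt_le_trans c0).
  rewrite -[c]mu_mean_cst; apply: le_mu_mean => s.
  by apply: le_trans (cN pi [::] s pi_HR) _; exact: absorbed_nd.
- by rewrite (funext (exp_moment_split pi)).
- move=> y Uy; rewrite -(cvg_lim _ Uu) //; apply: limr_le;
    first by apply: cvgP Uu.
  by near=> t; exact: Uy.
Unshelve. all: by end_near. Qed.

(** The threshold in [t] depends on [y] and [B] but not on the policy, as [optimal_SD] requires. *)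
Lemma g_to_ninfty (y : nat -> R) : y @ \oo --> +oo ->
  forall B, \forall t \near \oo, forall pi, is_HR pi -> y t <= moment pi t ->
    g p r mu t pi b <= B.
Proof.
move=> /cvgryPge yoo B; apply: filterS (yoo (expR (- b * B))) =>
  t Bt pi pi_HR le_y.
apply: le_trans (g_le pi_HR t b _ b_gt0 (expR_gt0 (- b * B)) (le_trans Bt
  le_y)) _.
by rewrite expRK mulrA mulrNN mulVf ?mul1r ?gt_eqF.
Qed.

Lemma g_cvg pi : is_HR pi ->
  (exists l : R, (fun t => g p r mu t pi b) @ \oo --> l) \/
  (forall B, \forall t \near \oo, g p r mu t pi b <= B).
Proof.
move=> pi_HR; pose U t := \sum_s mu s * absorbed pi t.+1 [::] s.
have [ub|nub] := pselect (has_ubound (range U)).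
  have [u [u0 Fu _]] := exp_moment_cvg pi pi_HR ub.
  left; exists (- b^-1 * ln u).
  rewrite /g gt_eqF //; exact: cvg_neg_ln.
have ndU : nondecreasing_seq U.
  apply/nondecreasing_seqP => t; apply: le_mu_mean => s.
  exact: (absorbed_nd pi_HR b [::] s t.+1 t.+2 (leqnSn _)).
have Uoo : U @ \oo --> +oo.
  apply: nondecreasing_dvgn_lt => // cvU; apply: nub;
    exists (limn U) => _ [t _ <-].
  exact: nondecreasing_cvgn_le.
right=> B; apply: filterS (g_to_ninfty U Uoo B) => t; apply => //.
exact: exp_moment_ge.
Qed.

(** The value iteration [z] lies below the moments of all policies. If it converges to [zoo], the
    greedy [d] has absorbed part, hence limiting moment, at most the mean of [zoo], and the lower
    bound for every policy tends to that same mean. If it is unbounded at [s], the mass [mu s]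
    drives ERM to minus infinity uniformly in the policy. *)
Lemma optimal_SD :
  (forall B, \forall t \near \oo, forall pi, is_HR pi -> g p r mu t pi b <= B) \/
  (exists d (l : R), (fun t => g p r mu t (SD_policy d) b) @ \oo --> l /\
    forall e, 0 < e -> \forall t \near \oo, forall pi, is_HR pi ->
      g p r mu t pi b <= l + e).
Proof.
pose x0 (s : state) : R := (s == sink)%:R.
pose z := value_iter a0 (tilted p r b) x0.
have x0_le s : x0 s <= bellman a0 (tilted p r b) x0 s.
  have [a ->] := bellman_attained a0 (tilted p r b) x0 s; exact: ge_tilted_sink.
have z_nd s : nondecreasing_seq (z ^~ s) by exact:
  value_iter_nd (tilted_ge0 b) _ x0_le s.
have z_le pi t : is_HR pi -> \sum_s mu s * z t.+1 s <= moment pi t.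
  move=> pi_HR; apply: le_trans (exp_moment_ge pi t pi_HR);
    apply: le_mu_mean => s.
  apply: (tilt_ev_ge pi_HR b _ z) => // n s' a; exact: bellman_le.
have [ub|] := pselect (forall s, has_ubound (range (z ^~ s))).
  right; have [zoo [d [z_cvg z_le_oo dz]]] :=
    value_iter_greedy a0 _ (tilted_ge0 b) _ x0_le ub.
  have U_le t : \sum_s mu s * absorbed (SD_policy d) t.+1 [::] s <=
    \sum_s mu s * zoo s.
    apply: le_mu_mean => s; apply: tilt_ev_SD_le => // s'; exact: (z_le_oo 0%N).
  have [|u [u0 Fu le_u]] := exp_moment_cvg (SD_policy d) (SD_HR d).
    by exists (\sum_s mu s * zoo s) => _ [t _ <-].
  exists d, (- b^-1 * ln u); split; first by rewrite /g gt_eqF //;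
    exact: cvg_neg_ln.
  move=> e e0; have z0 : 0 < \sum_s mu s * zoo s by exact:
    lt_le_trans (le_u _ U_le).
  have mz : (fun t => \sum_s mu s * z t.+1 s) @ \oo --> \sum_s mu s * zoo s.
    apply: (cvg_linear_comb mu (fun s t => z t.+1 s)) => s.
    by rewrite (cvg_shiftS (z ^~ s)); exact: z_cvg.
  have lt_e : - b^-1 * ln (\sum_s mu s * zoo s) < - b^-1 * ln u + e.
    apply: le_lt_trans (_ : - b^-1 * ln u < _); last by rewrite ltrDl.
    rewrite ler_wnM2l ?oppr_le0 ?invr_ge0 ?(ltW b_gt0) //.
    by rewrite ler_ln ?posrE //; exact: le_u.
  near=> t => pi pi_HR; apply:
    (@le_trans _ _ (- b^-1 * ln (\sum_s mu s * z t.+1 s))).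
    apply: g_le => //; last exact: z_le.
    by near: t; exact: (cvgr_gt _ mz).
  by near: t; apply: (cvgr_le _ (cvg_neg_ln b _ _ z0 mz)).
move=> /existsNP[s nub]; left => B.
(* At the sink [z] stays at most 1, so [s] carries initial mass. *)
have sn : s != sink.
  apply/eqP => ss; apply: nub; rewrite ss; exists 1 => _ [n _ <-].
  elim: n => [|n]; first by rewrite /z /value_iter /= /x0 eqxx.
  apply: le_trans; apply: le_trans (bellman_le a0 _ (z n) sink a0) _.
  by rewrite sum_tilted_sink.
have zoo : z ^~ s @ \oo --> +oo.
  apply: nondecreasing_dvgn_lt => // cvz; apply: nub;
    exists (limn (z ^~ s)) => _ [t _ <-].
  exact: nondecreasing_cvgn_le.
have moo : (fun t => mu s * z t.+1 s) @ \oo --> +oo.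
  apply/cvgryPge => K; have := zoo; rewrite -(cvg_shiftS (z ^~ s)).
  move=> /cvgryPge/(_ (K / mu s)); apply: filterS => t.
  by rewrite ler_pdivrMr ?mu_pos // mulrC.
apply: filterS (g_to_ninfty _ moo B) => t tB pi pi_HR; apply: tB => //.
apply: le_trans (z_le pi t pi_HR); rewrite (bigD1 s) //= lerDl sumr_ge0 // => i _.
rewrite mulr_ge0 ?mu_ge0 //; apply: le_trans (z_nd i 0%N t.+1 (leq0n _)).
exact: ler0n.
Unshelve. all: by end_near. Qed.

End ExponentialMoment.

(** * Convergence of EVaR and optimality of the grid maximizer *)

Section EVaR.
Context {alpha : R} (alpha_gt0 : 0 < alpha) (alpha_lt1 : alpha < 1).

Lemma ln_alpha_lt0 : ln alpha < 0.
Proof. by rewrite ln_lt0 // alpha_gt0. Qed.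

(** Controls levels below a grid: ERM is at most the mean, and the penalty is at least as strong as
    at [c]. *)
Lemma h_le_mean pi t b c : is_HR pi -> 0 < b -> b <= c ->
  h p r mu alpha t pi b <= g p r mu t pi 0 + c^-1 * ln alpha.
Proof.
move=> pi_HR b0 bc; apply: lerD; first exact: g_nonincreasing (ltW b0).
rewrite ler_wnM2r ?(ltW ln_alpha_lt0) // lef_pV2 ?posrE //.
exact: lt_le_trans bc.
Qed.

Lemma le_evar pi t b : is_HR pi -> 0 < b ->
  h p r mu alpha t pi b <= evar p r mu alpha t pi.
Proof.
move=> pi_HR b0; apply: ub_le_sup; last by exists b => //=; rewrite in_itv /= b0.
exists (g p r mu t pi 0) => _ [c /= + <-]; rewrite in_itv /= andbT => c0.
apply: le_trans (h_le_mean pi t c c pi_HR c0 (lexx c)) _.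
by rewrite gerDl mulr_ge0_le0 ?invr_ge0 ?(ltW c0) // ltW // ln_alpha_lt0.
Qed.

Lemma evar_le pi t y : (forall b, 0 < b -> h p r mu alpha t pi b <= y) ->
  evar p r mu alpha t pi <= y.
Proof.
move=> hy; apply: ge_sup.
  by exists (h p r mu alpha t pi 1), 1 => //=; rewrite in_itv /= ltr01.
by move=> _ [b /= + <-]; rewrite in_itv /= andbT; exact: hy.
Qed.

(** Levels up to [b0] are controlled by the mean, higher ones are rounded to the grid at cost
    [delta]; finitely many conditions share one horizon. *)
Lemma evar_le_near pi b0 delta y : is_HR pi -> 0 < delta ->
  0 < b0 -> b0 < - ln alpha / delta ->
  (\forall t \near \oo, g p r mu t pi 0 + b0^-1 * ln alpha <= y) ->
  (forall b, 0 < b -> Bgrid alpha b0 delta b ->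
    \forall t \near \oo, h p r mu alpha t pi b <= y - delta) ->
  \forall t \near \oo, evar p r mu alpha t pi <= y.
Proof.
move=> pi_HR d0 b00 b0lt mean_y grid_y.
have [n [c [c_grid c_le]]] :=
  Bgrid_discretization alpha b0 delta alpha_lt1 alpha_gt0 d0 b00 b0lt.
have all_y : \forall t \near \oo, forall i, h p r mu alpha t pi (c i) <=
  y - delta.
  apply: filter_forall => i; apply: grid_y => //.
  exact: Bgrid_gt0 b00 b0lt (c_grid i).
near=> t; apply: evar_le => b bgt0.
have [bb0|b0b] := leP b b0.
  by apply: le_trans (h_le_mean pi t b b0 pi_HR bgt0 bb0) _; near: t.
rewrite -(subrK delta y); apply: (c_le (g p r mu t pi)) => [b1 b2 b10 b12||].
- exact: g_nonincreasing (ltW b10) b12.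
- by near: t.
- exact: ltW.
Unshelve. all: by end_near. Qed.

(** The limit is the supremum [I] of the finite limits of [h] over [b > 0]: each of them bounds EVaR
    from below, and a grid with step [e / 2] bounds it from above. *)
Lemma evar_cvg pi : is_HR pi -> cvgn (fun t => evar p r mu alpha t pi).
Proof.
move=> pi_HR; have [C /(_ pi pi_HR)[_ leC]] := mean_cvg.
have lna := ln_alpha_lt0.
pose E := [set l : R | exists b, 0 < b /\ (fun t =>
  h p r mu alpha t pi b) @ \oo --> l].
have h_le_C t b : 0 < b -> h p r mu alpha t pi b <= C.
  move=> b0; apply: le_trans (h_le_mean pi t b b pi_HR b0 (lexx b)) _.
  apply: le_trans (leC t); rewrite gerDl mulr_ge0_le0 ?invr_ge0 ?(ltW b0) //.
  exact: ltW.
have ubE : has_ubound E.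
  exists C => l [b [b0 hl]]; apply: (cvgr_to_le hl).
  by near=> t; exact: h_le_C.
have h_cvg b l : (fun t => g p r mu t pi b) @ \oo --> l ->
    (fun t => h p r mu alpha t pi b) @ \oo --> l + b^-1 * ln alpha.
  by move=> gl; apply: cvgD => //; exact: cvg_cst.
(* At [b1] the moment bound [B] keeps ERM above [- b1^-1 * ln B], so it must converge. *)
have E0 : E !=set0.
  have [b1 [B [b10 FB]]] := small_exp_moment.
  have [[l gl]|goo] := g_cvg b1 b10 pi pi_HR.
    by exists (l + b1^-1 * ln alpha), b1; split => //; exact: h_cvg.
  have [N _ /(_ N (leqnn N))] := goo (- b1^-1 * ln B - 1).
  have B0 : 0 < B.
    apply: lt_le_trans (FB b1 pi 0%N pi_HR b10 (lexx _)); exact: exp_moment_gt0.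
  have := g_ge pi_HR N b1 B b10 B0 (FB b1 pi N pi_HR b10 (lexx _)); lra.
pose I := sup E; apply/cvg_ex; exists I; apply/cvgrPdist_le => e e0.
have [l [b [b0 hl]] Il] := sup_adherent e0 (conj E0 ubE).
have lower : \forall t \near \oo, I - e <= evar p r mu alpha t pi.
  have h_ge := cvgr_ge _ hl _ Il; near=> t.
  by apply: (le_trans _ (le_evar pi t b pi_HR b0)); near: t; exact: h_ge.
have upper : \forall t \near \oo, evar p r mu alpha t pi <= I + e.
  (* [X^-1] is the first grid point: [X] is so large that [C + X * ln alpha <= I + e] and that
     [X^-1] lies below the last grid point. *)
  pose X := (e + `|C - I| + 1) / - ln alpha.
  have X0 : 0 < X by rewrite divr_gt0 ?oppr_gt0 // ltr_pwDr // addr_ge0 // ltW.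
  have Xln : X * ln alpha = - (e + `|C - I| + 1).
    by rewrite /X; field; rewrite lt_eqF.
  have e20 : 0 < e / 2 by rewrite divr_gt0.
  apply: (evar_le_near pi X^-1 (e / 2) _ pi_HR e20).
  - by rewrite invr_gt0.
  - rewrite ltr_pdivlMr // mulrC ltr_pdivrMr // mulrC.
    have := Xln; have := normr_ge0 (C - I); lra.
  - near=> t; rewrite invrK Xln; have := leC t; have := ler_norm (C - I); lra.
  - move=> c c0 _; have [[l' gl]|goo] := g_cvg c c0 pi pi_HR.
      have l'I : l' + c^-1 * ln alpha <= I.
        by apply: ub_le_sup => //; exists c; split => //; exact: h_cvg.
      by apply: (cvgr_le _ (h_cvg c l' gl)); lra.
    have := goo (I + e / 2 - c^-1 * ln alpha); apply: filterS => t.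
    by rewrite /h; lra.
near=> t; rewrite ler_norml; apply/andP; split.
- have : evar p r mu alpha t pi <= I + e by near: t.
  lra.
- have : I - e <= evar p r mu alpha t pi by near: t.
  lra.
Unshelve. all: by end_near. Qed.

Lemma gstar_le t b y : (forall pi, is_HR pi -> g p r mu t pi b <= y) ->
  gstar p r mu t b <= y.
Proof.
move=> gy; apply: ge_sup; last by move=> _ [pi pi_HR <-]; exact: gy.
by exists (g p r mu t (SD_policy (fun=> a0)) b), (SD_policy (fun=> a0)) => //;
  exact: SD_HR.
Qed.

Lemma le_gstar0 pi t : is_HR pi -> g p r mu t pi 0 <= gstar p r mu t 0.
Proof.
move=> pi_HR; have [C HC] := mean_cvg; apply: ub_le_sup; last by exists pi.
by exists C => _ [pi' pi'_HR <-]; exact: (HC pi' pi'_HR).2.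
Qed.

(** [l] stands in for [gstar_inf] at [beta0], which may still be minus infinity when divergence at
    [beta0] is being refuted. *)
Lemma mean_le_of_gap beta0 delta l :
  (gstar_inf p r mu 0 - gstar_inf p r mu beta0 <= delta%:E)%E ->
  (gstar_inf p r mu beta0 <= l%:E)%E ->
  forall pi e, is_HR pi -> 0 < e ->
    \forall t \near \oo, g p r mu t pi 0 <= l + delta + e.
Proof.
move=> gap le_l pi e pi_HR e0;
  have [C /(_ pi pi_HR)[/cvg_ex[m gm] _]] := mean_cvg.
apply: (cvgr_le _ gm); suff : m - e / 2 - l <= delta by lra.
rewrite -lee_fin EFinB; apply: le_trans gap; apply: leeB => //.
apply: limn_einf_ge; have me : m - e / 2 < m by lra.
have m_ge := cvgr_ge _ gm _ me; near=> t.
by apply: (le_trans _ (le_gstar0 pi t pi_HR)); near: t; exact: m_ge.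
Unshelve. all: by end_near. Qed.

(** With [H] the maximal grid value, EVaR of [dstar] is at least [H] in the limit. For any [pi] it
    is eventually at most [H + delta + e]: at grid points [optimal_SD] reduces to stationary
    policies, covered by [argmax], and below [beta0] the gap hypothesis bounds the mean. *)
Lemma evar_argmax_gap delta beta0 dstar betastar :
  0 < delta -> 0 < beta0 -> beta0 < - ln alpha / delta ->
  (gstar_inf p r mu 0 - gstar_inf p r mu beta0 <= delta%:E)%E ->
  Bgrid alpha beta0 delta betastar ->
  (forall (d : state -> A) (beta : R), Bgrid alpha beta0 delta beta ->
      (h_inf p r mu alpha (SD_policy d) beta
         <= h_inf p r mu alpha (SD_policy dstar) betastar)%E) ->
  forall pi, is_HR pi ->
    limn (fun t => evar p r mu alpha t pi) - delta
      <= limn (fun t => evar p r mu alpha t (SD_policy dstar)).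
Proof.
move=> d0 b00 b0lt gap bs_grid argmax pi pi_HR.
have lna := ln_alpha_lt0.
have b0_grid : Bgrid alpha beta0 delta beta0.
  by right; exists 0%N; rewrite mul0r mul0r addr0 invrK.
have bs0 : 0 < betastar by exact: Bgrid_gt0 b00 b0lt bs_grid.
have h_inf_cvg d b l : (fun t => g p r mu t (SD_policy d) b) @ \oo --> l ->
    h_inf p r mu alpha (SD_policy d) b = (l + b^-1 * ln alpha)%:E.
  move=> gl; rewrite /h_inf EFinD; congr (_ + _)%E.
  suff gE : (fun t => (g p r mu t (SD_policy d) b)%:E) @ \oo --> l%:E.
    by rewrite (cvg_limn_einf_sup gE).1.
  by apply: cvg_EFin => //; near=> t.
have [d1 [l1 [gl1 le_l1]]] : exists d (l : R),
    (fun t => g p r mu t (SD_policy d) beta0) @ \oo --> l /\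
    forall e, 0 < e -> \forall t \near \oo, forall pi, is_HR pi ->
      g p r mu t pi beta0 <= l + e.
  (* Divergence at [beta0] would, through the gap, force the limiting mean to satisfy
     [m <= m - 1]. *)
  have [goo|//] := optimal_SD beta0 b00.
  have [C /(_ _ pi_HR)[/cvg_ex[m gm] _]] := mean_cvg.
  have le_B : (gstar_inf p r mu beta0 <= (m - delta - 2)%:E)%E.
    by apply: limn_einf_le; apply: filterS (goo _) => t; exact: gstar_le.
  have := mean_le_of_gap beta0 delta _ gap le_B pi 1 pi_HR ltr01.
  move=> /(cvgr_to_le gm); lra.
have gstar_l1 : (gstar_inf p r mu beta0 <= l1%:E)%E.
  apply/lee_addgt0Pr => e e0; rewrite -EFinD; apply: limn_einf_le.
  by apply: filterS (le_l1 e e0) => t; exact: gstar_le.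
have [ls gls] : exists ls : R,
    (fun t => g p r mu t (SD_policy dstar) betastar) @ \oo --> ls.
  (* Divergence would put the maximizer at least 1 below the pair of [d1] and [beta0]. *)
  have [//|goo] := g_cvg betastar bs0 (SD_policy dstar) (SD_HR dstar).
  have := argmax d1 beta0 b0_grid; rewrite (h_inf_cvg _ _ _ gl1).
  have := limn_einf_le _ _ (goo (l1 + beta0^-1 * ln alpha - betastar^-1 * ln
    alpha - 1)).
  move=> /(leeD2r (betastar^-1 * ln alpha)%:E) /[swap] /le_trans/[apply].
  rewrite -EFinD lee_fin; lra.
pose H := ls + betastar^-1 * ln alpha.
have le_H d b l : Bgrid alpha beta0 delta b ->
    (fun t => g p r mu t (SD_policy d) b) @ \oo --> l -> l + b^-1 * ln alpha <= H.
  move=> bg gl; have := argmax d b bg.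
  by rewrite (h_inf_cvg _ _ _ gl) (h_inf_cvg _ _ _ gls) lee_fin.
have H_le : H <= limn (fun t => evar p r mu alpha t (SD_policy dstar)).
  have hH : (fun t => h p r mu alpha t (SD_policy dstar) betastar) @ \oo --> H.
    by apply: cvgD => //; exact: cvg_cst.
  apply: (ler_cvg_to hH (evar_cvg (SD_policy dstar) (SD_HR dstar))).
  by near=> t; apply: le_evar => //; exact: SD_HR.
rewrite lerBlDr; apply: le_trans (_ : _ <= H + delta) _; last by rewrite lerD2r.
apply/ler_addgt0Pr => e e0.
apply: (cvgr_to_le (evar_cvg pi pi_HR)).
apply: (evar_le_near pi beta0 delta _ pi_HR d0 b00 b0lt).
  have := mean_le_of_gap beta0 delta l1 gap gstar_l1 pi e pi_HR e0.
  apply: filterS => t; have := le_H d1 beta0 l1 b0_grid gl1; lra.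
move=> b bgt0 bg; have [goo|[d [l [gl le_l]]]] := optimal_SD b bgt0.
  have := goo (H + e - b^-1 * ln alpha); apply: filterS => t /(_ pi pi_HR).
  by rewrite /h; lra.
have := le_l e e0; apply: filterS => t /(_ pi pi_HR).
by have := le_H d b l bg gl; rewrite /h; lra.
Unshelve. all: by end_near. Qed.

End EVaR.

End MDPTheory.

Theorem theorem3 (R : realType) (S : nat) (A : finType)
  (p r : 'I_S.+1 -> A -> 'I_S.+1 -> R) (mu : 'I_S.+1 -> R)
  (alpha delta beta0 : R)
  (* transition kernel *)
  (p_ge0 : forall s a s', 0 <= p s a s')
  (p_sum1 : forall s a, \sum_(s' : 'I_S.+1) p s a s' = 1)
  (* sink state e *)
  (p_sink : forall a, p (sink) a (sink) = 1)
  (r_sink : forall a, r (sink) a (sink) = 0)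
  (* initial distribution on the non-sink states, positive there *)
  (mu_sink : mu (sink) = 0)
  (mu_pos : forall s, s != sink -> 0 < mu s)
  (mu_sum1 : \sum_(s : 'I_S.+1) mu s = 1)
  (* transience under every stationary deterministic policy *)
  (transient : forall (d : 'I_S.+1 -> A) (s s' : 'I_S.+1),
      s != sink -> s' != sink ->
      cvgn (series (fun t => state_prob p (fun x => if x == s then 1 else 0)
                                       (SD_policy d) t s')))
  (alpha_gt0 : 0 < alpha) (alpha_lt1 : alpha < 1)
  (delta_gt0 : 0 < delta)
  (beta0_gt0 : 0 < beta0) (beta0_lt : beta0 < - ln alpha / delta)
  (hyp_beta0 : (gstar_inf p r mu 0 - gstar_inf p r mu beta0 <= delta%:E)%E)
  (dstar : 'I_S.+1 -> A) (betastar : R)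
  (betastar_in : Bgrid alpha beta0 delta betastar)
  (argmax : forall (d : 'I_S.+1 -> A) (beta : R), Bgrid alpha beta0 delta beta ->
      (h_inf p r mu alpha (SD_policy d) beta
         <= h_inf p r mu alpha (SD_policy dstar) betastar)%E) :
  cvgn (fun t => evar p r mu alpha t (SD_policy dstar)) /\
  (forall pi, is_HR pi -> cvgn (fun t => evar p r mu alpha t pi)) /\
  (forall pi, is_HR pi ->
     limn (fun t => evar p r mu alpha t pi) - delta
       <= limn (fun t => evar p r mu alpha t (SD_policy dstar))).
Proof.
have a0 : A := dstar sink.
(* The leading 1 keeps [M] positive when all rewards vanish. *)
pose M : R := 1 + \sum_s \sum_a \sum_s' `|r s a s'|.
have norm_ge0 s a : 0 <= \sum_s' `|r s a s'| by apply: sumr_ge0.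
have M_gt0 : 0 < M.
  by rewrite ltr_pwDl // sumr_ge0 // => s _; rewrite sumr_ge0.
have le_sum (I : finType) (f : I -> R) i : (forall j, 0 <= f j) -> f i <= \sum_j f j.
  by move=> f0; rewrite (bigD1 i) //= lerDl sumr_ge0.
have r_le s a s' : `|r s a s'| <= M.
  apply: le_trans (le_sum _ (fun s' => `|r s a s'|) s' _) _ => //.
  apply: le_trans (le_sum _ (fun a => \sum_s' `|r s a s'|) a _) _ => //.
  apply: le_trans (le_sum _ (fun s => \sum_a \sum_s' `|r s a s'|) s _) _.
    by move=> *; apply: sumr_ge0.
  by rewrite lerDr.
have cvg_all pi : is_HR pi -> cvgn (fun t => evar p r mu alpha t pi).
  exact: (evar_cvg p_ge0 p_sum1 p_sink r_sink a0 transient M M_gt0 r_le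
    mu_sink mu_pos mu_sum1 alpha_gt0 alpha_lt1).
split; first exact/cvg_all/SD_HR.
split=> // pi pi_HR.
exact: (evar_argmax_gap p_ge0 p_sum1 p_sink r_sink a0 transient M M_gt0 r_le
  mu_sink mu_pos mu_sum1 alpha_gt0 alpha_lt1 delta beta0 dstar betastar).
Qed.
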